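(* Let $G$ be a group and $N$ a normal subgroup of $G$. Let $\zeta_N$ be the group topology on $G$ for which $\{N\}$ is a base of neighborhoods of $e_G$. Then $(G,\zeta_N)$ is A-complete if and only if $G/N$ is a Taĭmanov group.
   Context: Group topologies are not assumed Hausdorff. A continuous group isomorphism $f:(G,\tau)\to(H,\sigma)$ of topological groups is semitopological if there exist a topological group $(\widetilde G,\widetilde\tau)$ containing $G$ as a normal subgroup with $\widetilde\tau$ inducing $\tau$ on $G$, and an open continuous homomorphism $\widetilde f:(\widetilde G,\widetilde\tau)\to(H,\sigma)$ extending $f$. A topological group $(G,\tau)$ (or its topology $\tau$) is A-complete if for every group topology $\sigma\le\tau$ on $G$ such that $id_G:(G,\tau)\to(G,\sigma)$ is semitopological, one has $\sigma=\tau$. The Taĭmanov topology $T_G$ on a group $G$ is the group topology whose neighborhoods of $e_G$ have as a base the centralizers $c_G(F)$ of finite subsets $F\subseteq G$. A group $G$ is Taĭmanov if $T_G$ is the discrete topology (equivalently, some finite $F\subseteq G$ has $c_G(F)=\{e_G\}$). *)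

(* Defs.v *)
From HB Require Import structures.
From mathcomp Require Import all_boot all_classical topology.

Set Implicit Arguments.
Unset Strict Implicit.
Unset Printing Implicit Defensive.

Import Algebra.
Local Open Scope classical_set_scope.
Local Open Scope quotient_scope.
Local Open Scope group_scope.

(* Several topologies live on one carrier, so a topology on T is an explicit
   object: the class of a topologicalType with carrier T.  Such a class also
   stores a (mathematically irrelevant) choice structure; two topologies are
   therefore compared through their open sets only. *)
Definition topology_on (T : Type) : Type := Topological.axioms_ T.

Definition space_of (T : Type) (c : topology_on T) : topologicalType :=
  Topological.Pack c.

Record group_topology (G : groupType) := GroupTopology {
  gtop : topology_on G;
  gtop_mul : continuous
    (fun p : space_of gtop * space_of gtop =>
       (p.1 : G) * (p.2 : G) : space_of gtop);
  gtop_inv : continuous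
    (fun x : space_of gtop => (x : G)^-1 : space_of gtop)
}.

Definition gspace (G : groupType) (tau : group_topology G) : topologicalType :=
  space_of (gtop tau).

Coercion gspace : group_topology >-> topologicalType.

Definition top_coarser (G : groupType) (sigma tau : group_topology G) : Prop :=
  @open sigma `<=` @open tau.

Definition top_eq (G : groupType) (sigma tau : group_topology G) : Prop :=
  @open sigma = @open tau.

(* The overgroup is given up to identification: G sits in E through an
   injective homomorphism i with normal image. *)
Definition semitopological (G H : groupType)
    (tau : group_topology G) (sigma : group_topology H) (f : G -> H) : Prop :=
  [/\ monoid_morphism f, bijective f, continuous (f : tau -> sigma) &
    exists (E : groupType) (tauE : group_topology E) (i : G -> E) (g : E -> H),
      [/\ [/\ monoid_morphism i, injective i &
              forall x y : E, range i x -> range i (x ^ y)],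
          @open tau = [set i @^-1` B | B in @open tauE],
          [/\ monoid_morphism g, continuous (g : tauE -> sigma) &
              forall A : set tauE, open A -> @open sigma (g @` A)]
        & forall x, g (i x) = f x]].

Definition A_complete (G : groupType) (tau : group_topology G) : Prop :=
  forall sigma : group_topology G, top_coarser sigma tau ->
    semitopological tau sigma id -> top_eq sigma tau.

Record group_filter_base (G : groupType) (B : set (set G)) : Prop :=
  GroupFilterBase {
    gfb_n0 : B !=set0;
    gfb_I : forall U V, B U -> B V -> exists2 W, B W & W `<=` U `&` V;
    gfb_1 : forall U, B U -> U 1;
    gfb_M : forall U, B U ->
      exists2 V, B V & forall x y, V x -> V y -> U (x * y);
    gfb_V : forall U, B U -> exists2 V, B V & forall x, V x -> U x^-1;
    gfb_J : forall U y, B U -> exists2 V, B V & forall x, V x -> U (x ^ y)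
  }.

Section GroupTopologyOf.
Context (G : groupType) (B : set (set G)) (hB : group_filter_base B).

Definition gfb_type of group_filter_base B : Type := G.
Local Notation T := (gfb_type hB).

HB.instance Definition _ := Choice.on T.

Definition gfb_nbhs (x : T) : set_system T :=
  [set A | exists2 U, B U & forall u : G, U u -> A ((x : G) * u)].

HB.instance Definition _ := hasNbhs.Build T gfb_nbhs.

Let nbhs_gfb_filter (x : T) : ProperFilter (nbhs x).
Proof.
apply: Build_ProperFilter_ex => [A [U BU UA]|].
  by exists ((x : G) * 1); exact: UA (gfb_1 hB BU).
split.
- by have [U BU] := gfb_n0 hB; exists U.
- move=> P Q [U BU UP] [V BV VQ].
  have [W BW WUV] := gfb_I hB BU BV.
  by exists W => // w /WUV[Uw Vw]; split; [exact: UP|exact: VQ].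
- by move=> P Q PQ [U BU UP]; exists U => // u /UP /PQ.
Qed.

Let nbhs_gfb_singleton (x : T) (A : set T) : nbhs x A -> A x.
Proof. by move=> [U BU /(_ 1 (gfb_1 hB BU))]; rewrite mulg1. Qed.

Let nbhs_gfb_nbhs (x : T) (A : set T) : nbhs x A -> nbhs x (nbhs^~ A).
Proof.
move=> [U BU UA]; have [V BV VU] := gfb_M hB BU.
exists V => // v Vv; exists V => // w Vw.
by rewrite /= -mulgA; apply: UA; exact: VU.
Qed.

HB.instance Definition _ := Nbhs_isNbhsTopological.Build T
  nbhs_gfb_filter nbhs_gfb_singleton nbhs_gfb_nbhs.

Definition gfb_topology : topology_on G := Topological.class T.

Fact gfb_mul_continuous : continuous
  (fun p : space_of gfb_topology * space_of gfb_topology =>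
     (p.1 : G) * (p.2 : G) : space_of gfb_topology).
Proof.
move=> [x0 y0] A; pose x : G := x0; pose y : G := y0 => -[U BU UA].
have [V BV VU] := gfb_M hB BU.
have [W BW WV] := gfb_J hB y BV.
exists ([set x * w | w in W], [set y * v | v in V]).
  by split; [exists W => // w ?; exists w|exists V => // v ?; exists v].
move=> [a b] /= [[w Ww <-] [v Vv <-]].
suff -> : x * w * (y * v) = x * y * (w ^ y * v).
  by apply: UA; apply: VU => //; exact: WV.
by rewrite conjgE !mulgA mulgK.
Qed.

Fact gfb_inv_continuous : continuous
  (fun x : space_of gfb_topology => (x : G)^-1 : space_of gfb_topology).
Proof.
move=> x0 A; pose x : G := x0 => -[U BU UA].
have [V BV VU] := gfb_J hB x^-1 BU.
have [W BW WV] := gfb_V hB BV.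
exists W => // w Ww; suff: A ((x * w)^-1) by [].
have -> : (x * w)^-1 = x^-1 * (w^-1 ^ x^-1).
  by rewrite conjgE invgM invgK !mulgA mulVg mul1g.
by apply: UA; apply: VU; exact: WV.
Qed.

Definition group_topology_of : group_topology G :=
  GroupTopology gfb_mul_continuous gfb_inv_continuous.

Lemma nbhs1_group_topology_of :
  nbhs ((1 : G) : group_topology_of) = filter_from B id.
Proof.
apply/seteqP; split=> A [U BU UA]; exists U => // u Uu.
  by rewrite -[u]mul1g; exact: UA.
by rewrite mul1g; exact: UA.
Qed.

End GroupTopologyOf.

Definition centralizer (G : groupType) (F : set G) : set G :=
  [set x | forall y, F y -> commute x y].

Definition finite_centralizers (G : groupType) : set (set G) :=
  [set centralizer F | F in finite_set].

Lemma finite_centralizers_base (G : groupType) :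
  group_filter_base (@finite_centralizers G).
Proof.
split.
- by exists (centralizer set0), set0.
- move=> _ _ [F finF <-] [F' finF' <-]; exists (centralizer (F `|` F')).
    by exists (F `|` F') => //; rewrite /= finite_setU.
  by move=> x xFF'; split=> y Fy; apply: xFF'; [left|right].
- by move=> _ [F _ <-] y _; exact/commute_sym/commute1.
- move=> _ [F finF <-]; exists (centralizer F); first by exists F.
  by move=> x y xF yF z Fz; apply/commute_sym/commuteM;
    apply/commute_sym; [exact: xF|exact: yF].
- move=> _ [F finF <-]; exists (centralizer F); first by exists F.
  by move=> x xF z Fz; apply/commute_sym/commuteV/commute_sym/xF.
- move=> _ y [F finF <-].
  exists (centralizer [set z ^ y^-1 | z in F]).
    by exists [set z ^ y^-1 | z in F] => //; exact: finite_image.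
  move=> x xF z Fz; have xz : commute x (z ^ y^-1) by apply: xF; exists z.
  by rewrite -[z](conjgKV y) /commute -!conjMg xz.
Qed.

Definition taimanov_topology (G : groupType) : group_topology G :=
  group_topology_of (finite_centralizers_base G).

Definition taimanov (G : groupType) : Prop :=
  forall A : set (taimanov_topology G), open A.

HB.mixin Record isConjClosed (G : groupType) (S : {pred G}) := {
  gpred_conj : forall x y, x \in S -> x ^ y \in S
}.

#[short(type="normalSubgroup")]
HB.structure Definition NormalSubgroup (G : groupType) :=
  {S of isConjClosed G S & GroupClosed G S}.

Lemma normal_base (G : groupType) (N : normalSubgroup G) :
  group_filter_base [set [set x | x \in N]].
Proof.
split.
- by exists [set x | x \in N].
- by move=> _ _ -> ->; exists [set x | x \in N] => // x.
- by move=> _ ->; exact: gpred1.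
- by move=> _ ->; exists [set x | x \in N] => // x y; exact: gpredM.
- by move=> _ ->; exists [set x | x \in N] => // x; rewrite /= gpredV.
- by move=> _ y ->; exists [set x | x \in N] => // x; exact: gpred_conj.
Qed.

Definition zeta (G : groupType) (N : normalSubgroup G) : group_topology G :=
  group_topology_of (normal_base N).

Section QuotientGroup.
Context (G : groupType) (N : normalSubgroup G).

Definition coset_eq (x y : G) : bool := x^-1 * y \in N.

Let coset_eq_refl : reflexive coset_eq.
Proof. by move=> x; rewrite /coset_eq mulVg gpred1. Qed.

Let coset_eq_sym : symmetric coset_eq.
Proof. by move=> x y; rewrite /coset_eq -gpredV invgM invgK. Qed.

Let coset_eq_trans : transitive coset_eq.
Proof.
move=> y x z xy yz; rewrite /coset_eq.
have -> : x^-1 * z = (x^-1 * y) * (y^-1 * z) by rewrite mulgA mulgK.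
exact: gpredM.
Qed.

Canonical coset_equiv := EquivRel coset_eq
  coset_eq_refl coset_eq_sym coset_eq_trans.

Definition quotient_group : Type := {eq_quot coset_equiv}.
Local Notation Q := quotient_group.

HB.instance Definition _ := Choice.on Q.
HB.instance Definition _ := EqQuotient.on Q.

Definition quotient_one : Q := \pi_Q 1.
Definition quotient_inv (a : Q) : Q := \pi_Q (repr a)^-1.
Definition quotient_mul (a b : Q) : Q := \pi_Q (repr a * repr b).

Let projP (a : Q) : exists x : G, \pi_Q x = a.
Proof. by exists (repr a); exact: reprK. Qed.

Let eqQ (x y : G) : x^-1 * y \in N -> \pi_Q x = \pi_Q y.
Proof. by move=> xy; apply/eqmodP. Qed.

Let reprQ (x : G) : (repr (\pi_Q x))^-1 * x \in N.
Proof.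
by have /eqmodP : \pi_Q (repr (\pi_Q x)) = \pi_Q x by rewrite reprK.
Qed.

Let quotient_mulE (x y : G) : quotient_mul (\pi_Q x) (\pi_Q y) = \pi_Q (x * y).
Proof.
apply: eqQ; set a := repr _; set b := repr _.
have -> : (a * b)^-1 * (x * y) = ((a^-1 * x) ^ b) * (b^-1 * y).
  by rewrite conjgE invgM !mulgA mulgK.
by apply: gpredM; [exact/gpred_conj/reprQ|exact: reprQ].
Qed.

Let quotient_invE (x : G) : quotient_inv (\pi_Q x) = \pi_Q x^-1.
Proof.
apply: eqQ; set a := repr _.
have -> : a^-1^-1 * x^-1 = ((a^-1 * x)^-1) ^ a^-1.
  by rewrite conjgE invgM !invgK mulgK.
by apply: gpred_conj; rewrite gpredV; exact: reprQ.
Qed.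

Let quotient_mulA : associative quotient_mul.
Proof.
move=> a b c; case: (projP a) (projP b) (projP c) => x <- [y <-] [z <-].
rewrite (quotient_mulE x y) (quotient_mulE y z).
by rewrite (quotient_mulE x) (quotient_mulE _ z) mulgA.
Qed.

Let quotient_mul1g : left_id quotient_one quotient_mul.
Proof. by move=> a; case: (projP a) => x <-; rewrite quotient_mulE mul1g. Qed.

Let quotient_mulg1 : right_id quotient_one quotient_mul.
Proof. by move=> a; case: (projP a) => x <-; rewrite quotient_mulE mulg1. Qed.

Let quotient_mulVg : left_inverse quotient_one quotient_inv quotient_mul.
Proof. by move=> a; case: (projP a) => x <-; rewrite (quotient_invE x) quotient_mulE mulVg. Qed.

Let quotient_mulgV : right_inverse quotient_one quotient_inv quotient_mul.
Proof. by move=> a; case: (projP a) => x <-; rewrite (quotient_invE x) quotient_mulE mulgV. Qed.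

HB.instance Definition _ := isGroup.Build Q
  quotient_mulA quotient_mul1g quotient_mulg1 quotient_mulVg quotient_mulgV.

Definition quotient_proj (x : G) : quotient_group := \pi_Q x.

Lemma quotient_proj_morphism : monoid_morphism quotient_proj.
Proof. by split=> // x y; rewrite [RHS]quotient_mulE. Qed.

Lemma quotient_proj_surj (a : quotient_group) : exists x, quotient_proj x = a.
Proof. exact: projP. Qed.

Lemma quotient_proj_eq1 (x : G) : quotient_proj x = 1 <-> x \in N.
Proof.
split=> [/esym/eqmodP|xN]; last by apply/esym/eqQ; rewrite invg1 mul1g.
by rewrite /= /coset_eq invg1 mul1g.
Qed.

End QuotientGroup.

(* Main.v *)
(** If [(G/N)] has a finite subset [F] with trivial centralizer and an overgroup
    [E] witnesses that [id : (G, zeta N) -> (G, sigma)] is semitopological, then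
    for each lift [a] of an element of [F] the commutators [[a, w]] lie in [N]
    for all [w] near [1] in [E].  Projecting to [G], a [sigma]-neighbourhood of
    [1] centralizes [F] modulo [N], hence is contained in [N].

    Conversely, let [sigma] be the preimage on [G] of the Taimanov topology of
    [G/N].  On [E = G * G] the subgroups
    [{(x, y) | x = y modulo N, y centralizes F modulo N}] are a base at [1] of a
    group topology: [(x, y) ^ (a, b)] is again in the diagonal modulo [N] as soon
    as [y] commutes with [a / b] modulo [N].  This topology induces [zeta N] on
    [G * 1] and the first projection is open onto [(G, sigma)], so [id] is
    semitopological, and A-completeness forces [N] to be [sigma]-open. *)
Require Import Defs.
From HB Require Import structures.
From mathcomp Require Import all_boot all_classical topology.

Set Implicit Arguments.
Unset Strict Implicit.
Unset Printing Implicit Defensive.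

Import Algebra.
Local Open Scope classical_set_scope.
Local Open Scope group_scope.

Lemma open_group_topology_of (G : groupType) (B : set (set G))
    (hB : group_filter_base B) (A : set G) :
  @open (group_topology_of hB) A <->
  forall x, A x -> exists2 U, B U & forall u, U u -> A (x * u).
Proof. by rewrite openE. Qed.

Lemma monoid_morphismV (G H : groupType) (f : G -> H) :
  monoid_morphism f -> {morph f : x / x^-1}.
Proof. by move=> mf x; apply: (mulgI (f x)); rewrite -mf.2 !mulgV mf.1. Qed.

Section GroupTopologyContinuity.
Context (G : groupType) (tau : group_topology G).

Lemma continuous_gtop_mul (X : topologicalType) (f g : X -> tau) (x : X) :
  {for x, continuous f} -> {for x, continuous g} ->
  {for x, continuous (fun y => (f y : G) * (g y : G) : tau)}.
Proof.
move=> cf cg; apply: (continuous_comp (f := fun y => (f y, g y))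
    (g := fun p : tau * tau => (p.1 : G) * (p.2 : G) : tau)).
  exact: cvg_pair cf cg.
exact: gtop_mul.
Qed.

Lemma nbhs_translate (U : set tau) (x : tau) :
  nbhs ((1 : G) : tau) U -> nbhs x [set y : tau | U ((x : G)^-1 * (y : G))].
Proof.
move=> U1; have : {for x, continuous (fun y : tau => (x : G)^-1 * (y : G) : tau)}.
  by apply: continuous_gtop_mul => //; exact: cvg_cst.
by apply; rewrite mulVg.
Qed.

(** The map sending [w] to [[~ a, w]] is continuous and fixes 1. *)
Lemma nbhs1_commg (a : G) (U : set tau) :
  nbhs ((1 : G) : tau) U ->
  nbhs ((1 : G) : tau) [set w : tau | U [~ a, (w : G)]].
Proof.
move=> U1; have : {for (1 : G) : tau,
    continuous (fun w : tau => [~ a, (w : G)] : tau)}.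
  apply: continuous_gtop_mul; first exact: cvg_cst.
  apply: continuous_gtop_mul; first exact: gtop_inv.
  by apply: continuous_gtop_mul => //; exact: cvg_cst.
by apply; rewrite commg1.
Qed.

End GroupTopologyContinuity.

Section Zeta.
Context (G : groupType) (N : normalSubgroup G).

Lemma open_zeta (A : set G) :
  @open (zeta N) A <-> forall x n, A x -> n \in N -> A (x * n).
Proof.
rewrite open_group_topology_of; split=> [AN x n /AN[_ ->]|AN x Ax].
  exact.
by exists [set n | n \in N] => // n; exact: AN.
Qed.

(** A [zeta N]-open set contains the coset [x N] of each of its points [x], and this coset is a
    [sigma]-neighbourhood of [x] by translation. *)
Lemma top_coarser_zeta (sigma : group_topology G) :
  nbhs ((1 : G) : sigma) [set x | x \in N] -> top_coarser (zeta N) sigma.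
Proof.
move=> N1 A /open_zeta AN; rewrite openE => x Ax.
apply: (filterS _ (nbhs_translate x N1)) => y /= xyN.
by have := AN _ _ Ax xyN; rewrite mulgA mulgV mul1g.
Qed.

End Zeta.

Lemma taimanovP (G : groupType) :
  taimanov G <->
  exists2 F : set G, finite_set F & forall x, centralizer F x -> x = 1.
Proof.
split=> [/(_ [set 1])/open_group_topology_of/(_ 1 erefl)|[F finF F1] A].
  by move=> [_ [F finF <-] F1]; exists F => // x /F1; rewrite mul1g.
apply/open_group_topology_of => x Ax; exists (centralizer F); first by exists F.
by move=> u /F1 ->; rewrite mulg1.
Qed.

HB.instance Definition _ (G : groupType) (N : normalSubgroup G) :=
  isUMagmaMorphism.Build G (quotient_group N) (@quotient_proj G N)
    (@quotient_proj_morphism G N).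

Lemma nbhs1_semitopological_taimanov (G : groupType) (N : normalSubgroup G)
    (sigma : group_topology G) :
  taimanov (quotient_group N) -> semitopological (zeta N) sigma id ->
  nbhs ((1 : G) : sigma) [set x | x \in N].
Proof.
move=> /taimanovP[F finF F1] [_ _ _].
move=> [E [tauE [i [g [[mi _ nori] indE [mg _ openg] gi]]]]].
have : @open (zeta N) [set x | x \in N].
  by apply/open_zeta => x n /= xN nN; exact: gpredM.
rewrite indE => -[U openU UN].
have U1 : nbhs ((1 : E) : tauE) U.
  apply: open_nbhs_nbhs; split=> //.
  have : (i @^-1` U) 1 by rewrite UN; exact: gpred1.
  by rewrite /= mi.1.
pose W a := [set w : tauE | U [~ i (repr (a : quotient_group N)), (w : E)]].
(* Finiteness of [F] keeps the intersection a neighbourhood. *)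
have W1 : nbhs ((1 : E) : tauE) (\bigcap_(a in F) W a).
  have /finite_fsetP[X ->] := finF.
  by apply: filter_bigI => a _; exact: nbhs1_commg.
have gW w : (\bigcap_(a in F) W a) w -> g w \in N.
  move=> Ww; apply/quotient_proj_eq1/F1 => a Fa.
  set x := repr a; have px : quotient_proj N x = a by exact: generic_quotient.reprK.
  (* The commutator is [(i x)^-1 * (i x) ^ w], which stays in the image of [i] because that image is
     normal. *)
  have [y _ iy] : range i [~ i x, w].
    rewrite commgEl; have [z _ <-] : range i (i x ^ w).
      by apply: nori; exists x.
    exists (x^-1 * z) => //; rewrite mi.2; congr (_ * _).
    exact: monoid_morphismV.
  have yN : y \in N.
    suff : (i @^-1` U) y by rewrite UN.
    by rewrite /= iy; exact: Ww.
  (* Apply [g], which is the identity on the copy of [G]. *)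
  have xw : y = [~ x, g w].
    by rewrite -[y]gi iy !mg.2 !(monoid_morphismV mg) !gi.
  apply/commute_sym/commgP/eqP; rewrite -px -gmulfR -xw.
  exact/quotient_proj_eq1.
rewrite nbhsE in W1; case: W1 => V [openV V1] VW.
have gV1 : nbhs ((1 : G) : sigma) (g @` V).
  by apply: open_nbhs_nbhs; split; [exact: openg|exists (1 : E) => //; exact: mg.1].
by apply: filterS gV1 => _ [w /VW/gW gwN <-].
Qed.

Section PreimageBases.
Context (G Q : groupType) (f : UMagmaMorphism.type G Q).

Lemma preimage_base (B : set (set Q)) :
  group_filter_base B -> group_filter_base [set f @^-1` U | U in B].
Proof.
move=> hB; split.
- by have [U BU] := gfb_n0 hB; exists (f @^-1` U), U.
- move=> _ _ [U BU <-] [V BV <-]; have [W BW WUV] := gfb_I hB BU BV.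
  by exists (f @^-1` W); [exists W|move=> x /WUV].
- by move=> _ [U BU <-]; rewrite /= gmulf1; exact: (gfb_1 hB).
- move=> _ [U BU <-]; have [V BV VU] := gfb_M hB BU.
  exists (f @^-1` V); first by exists V.
  by move=> x y Vx Vy; rewrite /= gmulfM; exact: VU.
- move=> _ [U BU <-]; have [V BV VU] := gfb_V hB BU.
  exists (f @^-1` V); first by exists V.
  by move=> x Vx; rewrite /= gmulfV; exact: VU.
- move=> _ y [U BU <-]; have [V BV VU] := gfb_J hB (f y) BU.
  exists (f @^-1` V); first by exists V.
  by move=> x Vx; rewrite /= gmulfJ; exact: VU.
Qed.

(** The part lying over [C] of the fibre product of [f] with itself. *)
Definition fiber_diagonal (C : set Q) : set (G * G) :=
  [set p | f p.1 = f p.2 /\ C (f p.2)].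

Lemma fiber_diagonal_base :
  group_filter_base [set fiber_diagonal C | C in @finite_centralizers Q].
Proof.
have hB := finite_centralizers_base Q; split.
- by have [U BU] := gfb_n0 hB; exists (fiber_diagonal U), U.
- move=> _ _ [U BU <-] [V BV <-]; have [W BW WUV] := gfb_I hB BU BV.
  by exists (fiber_diagonal W); [exists W|move=> x [fx /WUV[]]].
- by move=> _ [U BU <-]; split; rewrite //= gmulf1; exact: (gfb_1 hB).
- move=> _ [U BU <-]; have [V BV VU] := gfb_M hB BU.
  exists (fiber_diagonal V); first by exists V.
  move=> x y [fx Vx] [fy Vy]; split; rewrite /= !gmulfM ?fx ?fy //.
  exact: VU.
- move=> _ [U BU <-]; have [V BV VU] := gfb_V hB BU.
  exists (fiber_diagonal V); first by exists V.
  by move=> x [fx Vx]; split; rewrite /= !gmulfV ?fx //; exact: VU.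
- move=> _ [a b] [U BU <-]; have [V BV VU] := gfb_J hB (f b) BU.
  (* The conjugate by [(a, b)] stays in the fibre product when [f y ^ f a = f y ^ f b], that is,
     when [f y] commutes with [f a / f b]; centralizing this one further element is again a basic
     condition. *)
  have BC : finite_centralizers (centralizer [set f a / f b]).
    by exists [set f a / f b] => //; exact: finite_set1.
  have [W BW WVC] := gfb_I hB BV BC.
  exists (fiber_diagonal W); first by exists W.
  move=> [x y] [/= fx /WVC[Vy Cy]]; split; rewrite /= !gmulfJ ?fx; last exact: VU.
  have /commgP/conjg_fixP : commute (f y) (f a / f b) by exact: Cy.
  by rewrite conjgM => /(canRL (conjgKV _)) ->.
Qed.

End PreimageBases.

Section TaimanovPreimage.
Context (G : groupType) (N : normalSubgroup G).

Definition taimanov_preimage : group_topology G :=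
  group_topology_of (preimage_base (quotient_proj N)
    (finite_centralizers_base (quotient_group N))).

Lemma open_taimanov_preimage (A : set G) :
  @open taimanov_preimage A <->
  forall x, A x -> exists2 C, @finite_centralizers (quotient_group N) C &
    forall u, C (quotient_proj N u) -> A (x * u).
Proof.
rewrite open_group_topology_of; split=> AC x /AC.
  by move=> [_ [C finC <-] CA]; exists C.
by move=> [C finC CA]; exists (quotient_proj N @^-1` C) => //; exists C.
Qed.

Lemma taimanov_preimage_coarser : top_coarser taimanov_preimage (zeta N).
Proof.
move=> A /open_taimanov_preimage AC; apply/open_zeta => x n /AC[C finC CA] nN.
apply: CA; have /quotient_proj_eq1 -> := nN.
exact: (gfb_1 (finite_centralizers_base _) finC).
Qed.

Lemma semitopological_taimanov_preimage :
  semitopological (zeta N) taimanov_preimage id.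
Proof.
split; [by split|by exists id| |].
  apply/continuousP => A openA; exact: taimanov_preimage_coarser.
exists (G * G)%type, (group_topology_of (fiber_diagonal_base (quotient_proj N))).
exists (fun x => (x, 1)), fst; split=> //.
- split.
  + by split=> // x y; congr pair; rewrite mulg1.
  + by move=> x y [].
  + by move=> _ [a b] [x _ <-]; exists (x ^ a) => //; congr pair; exact/esym/conj1g.
- apply/seteqP; split=> A.
  (* This set traces [A] on the pairs [(x, 1)]. Moving within the fibre product changes
     [p.1 * p.2^-1] only by an element of [N], so the whole group, [centralizer set0], serves as
     base set. *)
  + move/open_zeta => AN; exists [set p | A (p.1 * p.2^-1)].
      apply/open_group_topology_of => -[x y] /= Axy.
      exists (fiber_diagonal (quotient_proj N) (centralizer set0)).
        by exists (centralizer set0) => //; exists set0.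
      move=> [u v] [/= fuv _].
      have -> : x * u * (y * v)^-1 = x * y^-1 * ((u * v^-1) ^ y^-1).
        by rewrite conjgE invgM invgK !mulgA mulgVK.
      apply: AN => //; apply: gpred_conj; apply/quotient_proj_eq1.
      by rewrite gmulfF /= fuv mulgV.
    by apply/funext => x; rewrite /= invg1 mulg1.
  + move=> [B /open_group_topology_of BC <-]; apply/open_zeta => x n /= /BC.
    move=> [_ [C finC <-] CB] nN; have /quotient_proj_eq1 fn := nN.
    (* For [n] in [N], the pair [(n, 1)] lies in every basic neighbourhood. *)
    rewrite -[1]mulg1; apply: (CB (n, 1)); split; rewrite /= ?fn gmulf1 //.
    exact: (gfb_1 (finite_centralizers_base _) finC).
- split; first by split.
  + apply/continuousP => A /open_taimanov_preimage AC.
    apply/open_group_topology_of => -[x y] /= /AC[C finC CA].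
    exists (fiber_diagonal (quotient_proj N) C); first by exists C.
    by move=> [u v] [/= fuv Cv]; apply: CA; rewrite fuv.
  + move=> A /open_group_topology_of AC.
    apply/open_taimanov_preimage => _ [[x y] /AC[_ [C finC <-] CA] <-].
    (* The diagonal pair [(u, u)] lifts [u] into the basic neighbourhood. *)
    exists C => // u Cu; exists (x * u, y * u) => //.
    exact: (CA (u, u)).
Qed.

End TaimanovPreimage.

Theorem theorem5p15 (G : groupType) (N : normalSubgroup G) :
  A_complete (zeta N) <-> taimanov (quotient_group N).
Proof.
split=> [AN|taiQ sigma sigma_le semi]; last first.
  apply/seteqP; split=> //; apply: top_coarser_zeta.
  exact: nbhs1_semitopological_taimanov.
have eqT := AN _ (@taimanov_preimage_coarser G N)
  (@semitopological_taimanov_preimage G N).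
have : @open (zeta N) [set x | x \in N].
  by apply/open_zeta => x n /= xN nN; exact: gpredM.
(* Openness of [N] at 1 yields a finite [F] whose centralizer has its preimage inside [N], hence is
   trivial. *)
rewrite -eqT => /open_taimanov_preimage/(_ 1 gpred1).
move=> [_ [F finF <-] FN]; apply/taimanovP; exists F => // q.
have [x <-] := quotient_proj_surj q => /FN; rewrite /= mul1g => xN.
exact/quotient_proj_eq1.
Qed.
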